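(* Let $\hbar>0$ and let $f\in L^2(\mathbb{R})$ be such that the nodal set of $Wf$ is bounded and $Wf$ is centered at $z=0$. Suppose $Wf$ vanishes on the circle $|z|=R$ for some $R>0$. Then $R=\sqrt{\hbar p/2}$ where $p$ is a root of at least one Laguerre polynomial $L_n^{(k)}$ with $n\in\mathbb{N}$, $k\in\mathbb{N}_0$. Consequently, there are only countably many radii $R$ for circles centered at the origin on which such Wigner functions can vanish.
   Context: For $f,g\in L^2(\mathbb{R})$, $W(f,g)(x,p)=\frac{1}{2\pi\hbar}\int_{\mathbb{R}} f(x+\tau/2)\overline{g(x-\tau/2)}e^{-\frac{i}{\hbar}p\tau}\,d\tau$ and $Wf=W(f,f)$. Hermite functions: $h_n(x)=\frac{1}{\sqrt[4]{\pi\hbar}\sqrt{2^nn!}}e^{-x^2/(2\hbar)}H_n(x/\sqrt{\hbar})$, $H_n(x)=(-1)^ne^{x^2}\frac{d^n}{dx^n}e^{-x^2}$. A Wigner function $Wf$ with bounded nodal set is centered at $z_1$ if $Wf(z)=\sum_{n,m=0}^N b_n\overline{b_m}W(h_n,h_m)(S(z-z_1))$ for all $z$, for some $N\in\mathbb{N}_0$, $b_j\in\mathbb{C}$, and some real $2\times2$ matrix $S$ with $\det S=1$. Generalized Laguerre polynomials: $L_n^{(\alpha)}(x)=\sum_{j=0}^n(-1)^j\binom{n+\alpha}{n-j}\frac{x^j}{j!}$. *)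

(* Defs.v *)
From HB Require Import structures.
From mathcomp Require Import all_boot all_order all_algebra.
From mathcomp Require Import all_classical all_reals all_analysis.
From mathcomp Require Import complex.

Set Implicit Arguments.
Unset Strict Implicit.
Unset Printing Implicit Defensive.

Import Order.TTheory GRing.Theory Num.Theory.
Local Open Scope ring_scope.
Local Open Scope complex_scope.

Section Wigner.
Variable R : realType.

Definition cintegral (F : R -> R[i]) : R[i] :=
  (Rintegral (@lebesgue_measure R) setT (fun t => complex.Re (F t))) +i*
  (Rintegral (@lebesgue_measure R) setT (fun t => complex.Im (F t))).

Definition L2 (f : R -> R[i]) : Prop :=
  measurable_fun setT (fun x => complex.Re (f x)) /\
  measurable_fun setT (fun x => complex.Im (f x)) /\
  (@lebesgue_measure R).-integrable setT
     (fun x => ((complex.Re (f x)) ^+ 2 + (complex.Im (f x)) ^+ 2)%:E).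

Definition cexpm (theta : R) : R[i] := (cos theta) -i* (sin theta).

Definition wigner (hbar : R) (f g : R -> R[i]) (x p : R) : R[i] :=
  ((2 * pi * hbar)^-1)%:C *
  cintegral (fun tau => f (x + tau / 2) * (g (x - tau / 2))^* *
                        cexpm (p * tau / hbar)).

(* Hermite polynomials H_n via the Rodrigues formula *)
Definition hermiteH (n : nat) (x : R) : R :=
  (-1) ^+ n * expR (x ^+ 2) * derive1n n (fun y : R => expR (- y ^+ 2)) x.

Definition hermite_fun (hbar : R) (n : nat) (x : R) : R[i] :=
  ((Num.sqrt (Num.sqrt (pi * hbar)))^-1 * (Num.sqrt (2 ^+ n * (n`!)%:R))^-1 *
   expR (- x ^+ 2 / (2 * hbar)) * hermiteH n (x / Num.sqrt hbar))%:C.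

Definition mx_act (S : 'M[R]_2) (z : R * R) : R * R :=
  (S 0 0 * z.1 + S 0 1 * z.2, S 1 0 * z.1 + S 1 1 * z.2).

Definition bounded_nodal_set (hbar : R) (f : R -> R[i]) : Prop :=
  exists M : R, forall x p : R, wigner hbar f f x p = 0 -> x ^+ 2 + p ^+ 2 <= M ^+ 2.

Definition wigner_centered_at (hbar : R) (f : R -> R[i]) (z1 : R * R) : Prop :=
  exists (N : nat) (b : nat -> R[i]) (S : 'M[R]_2),
    \det S = 1 /\
    forall z : R * R,
      wigner hbar f f z.1 z.2 =
      \sum_(n < N.+1) \sum_(m < N.+1)
         b n * (b m)^* *
         wigner hbar (hermite_fun hbar n) (hermite_fun hbar m)
           (mx_act S (z.1 - z1.1, z.2 - z1.2)).1
           (mx_act S (z.1 - z1.1, z.2 - z1.2)).2.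

Definition vanishes_on_circle (hbar : R) (f : R -> R[i]) (Rad : R) : Prop :=
  forall x p : R, x ^+ 2 + p ^+ 2 = Rad ^+ 2 -> wigner hbar f f x p = 0.

Definition laguerre (n k : nat) (x : R) : R :=
  \sum_(j < n.+1) (-1) ^+ j * ('C(n + k, n - j))%:R * x ^+ j / (j`!)%:R.

End Wigner.

(* Main.v *)
Require Import Defs.
From HB Require Import structures.
From mathcomp Require Import all_boot all_order all_algebra.
From mathcomp Require Import all_classical all_reals all_analysis.
From mathcomp Require Import complex.
From mathcomp Require Import measurable_realfun.
From mathcomp Require Import ring lra zify.
Import Order.TTheory GRing.Theory Num.Theory.
Import numFieldNormedType.Exports.
Local Open Scope ring_scope.
Local Open Scope complex_scope.

(** Writing [w] for the complex coordinate of [S z / sqrt hbar], integration by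
    parts against a Gaussian times [exp (- i c t)] gives the ladder recurrences
    of [W(h_n, h_m)], hence [W(h_n, h_m) = g * P_nm (conj w, w)] with a common
    factor [g] and [P_nm] Ito's complex Hermite polynomial [ito n m].  Only
    [g <> 0] for small momentum is needed, since a Laurent polynomial vanishing
    at infinitely many points of the unit circle is zero.

    On the circle [w = al u + be / u] with [|u| = 1] and
    [|al|^2 - |be|^2 = Rad^2 / hbar].  Let [N] and [M] be the largest and the
    smallest index with [b_n <> 0].  The coefficient of [u ^ (2 N)] is a nonzero
    multiple of [(al * conj be) ^ N], so [be = 0]: [S] must be a rotation.  The
    coefficient of [u ^ (M - N)] then comes from the single pair [(N, M)] and
    is a nonzero multiple of [L_M ^ (N - M) (2 Rad^2 / hbar)]. *)

Local Open Scope classical_set_scope.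

(** * Gaussian moments *)

Section GaussianMoments.
Context {R : realType}.
Implicit Types (k c t : R) (q : {poly R}).

Local Notation mu := (@lebesgue_measure R).

(** The fundamental theorem of calculus on growing symmetric intervals leaves only boundary terms,
    and dominated convergence with majorant [|f|] passes to the line. Decay of [F] along the
    integers suffices. *)
Lemma Rintegral_derive_eq0 (F f : R -> R) :
  (forall x : R, is_derive x 1 F (f x)) -> continuous f ->
  mu.-integrable setT (EFin \o f) ->
  F n%:R @[n --> \oo] --> (0 : R) -> F (- n%:R) @[n --> \oo] --> (0 : R) ->
  \int[mu]_x f x = 0.
Proof.
move=> dF cf fi F1 F2.
have mf : measurable_fun setT f by exact: continuous_measurable_fun.
(* The bound [n.+1] keeps the interval nondegenerate at [n = 0]. *)
pose D (n : nat) : set R := `[- n.+1%:R, n.+1%:R].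
have DF (n : nat) : (\int[mu]_x (EFin \o f \_ (D n)) x = (F n.+1%:R - F (- n.+1%:R))%:E)%E.
  rewrite -restrict_EFin -integral_mkcond EFinB.
  apply: (@continuous_FTC2 _ f).
  - by rewrite (lt_trans (y := 0)) // ?oppr_lt0.
  - exact: continuous_subspaceT.
  - have cF x : {for x, continuous F}.
      by apply: differentiable_continuous; apply/derivable1_diffP; case: (dF x).
    split.
    + by move=> x _; case: (dF x).
    + exact/cvg_at_right_filter/cF.
    + exact/cvg_at_left_filter/cF.
  - by move=> x _; rewrite derive1E; exact: derive_val.
have [||||| _ _] := @dominated_convergence _ _ _ mu setT measurableT
  (fun n => EFin \o f \_ (D n)) (EFin \o f) (fun x => `|f x|%:E).
- move=> n; apply/measurable_EFinP/(measurable_restrictT _ _).1.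
    exact: measurable_itv.
  exact: measurable_funTS.
- exact/measurable_EFinP.
- apply/aeW => x _; apply/cvg_EFin; first by near=> n.
  apply: (@cvg_near_cst _ _ _ _ _ _); near=> n.
  rewrite /= patchE ifT// inE /D /= in_itv /= -ler_norml.
  near: n; exists (Num.truncn `|x|).+1 => // n /= nx.
  rewrite (le_trans (ltW (truncnS_gt _)))//.
  by rewrite ler_nat (leq_trans nx).
- by have /integrable_abse := fi.
- apply/aeW => x n _; rewrite /= patchE; case: ifP => _ //=.
  by rewrite normr0 lee_fin.
under eq_fun do rewrite DF.
move=> h.
have h2 : (F n.+1%:R - F (- n.+1%:R))%:E @[n --> \oo] --> (0 : R)%:E.
  apply/cvg_EFin; first by near=> n.
  rewrite -[X in _ --> X](subrr (0 : R)).
  apply: cvgB.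
    by rewrite -(cvg_shiftS (fun n => F n%:R)) in F1.
  by rewrite -(cvg_shiftS (fun n => F (- n%:R))) in F2.
by rewrite /Rintegral (cvg_unique _ h h2).
Unshelve. all: by end_near. Qed.

Definition gweight k t : R := expR (- (k * t ^+ 2)).

Lemma gweight_ge0 k t : 0 <= gweight k t.
Proof. exact: expR_ge0. Qed.

Lemma is_derive_gweight k t :
  is_derive t 1 (gweight k) (- (2 * k * t * gweight k t)).
Proof.
have h : is_derive t 1 (fun x : R => - (k * x ^+ 2)) (- (2 * k * t)).
  by apply: is_derive_eq; rewrite /GRing.scale /=; ring.
apply: is_derive_eq; rewrite /gweight /GRing.scale /=; ring.
Qed.

Lemma continuous_gweight k : continuous (gweight k).
Proof.
move=> t; apply: differentiable_continuous; apply/derivable1_diffP.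
by case: (is_derive_gweight k t).
Qed.

Lemma gweightD k l t : gweight k t * gweight l t = gweight (k + l) t.
Proof. by rewrite /gweight -expRD; congr expR; ring. Qed.

Lemma gweight_normal_fun k : 0 < k ->
  gweight k = normal_fun 0 (Num.sqrt (2 * k))^-1.
Proof.
move=> k0; apply/funext => t; rewrite /gweight /normal_fun; congr expR.
rewrite exprVn sqr_sqrtr; last by rewrite mulr_ge0 // ltW.
rewrite subr0 -mulr_natl; field.
by rewrite gt_eqF.
Qed.

(** Reduction to a normal density, whose integrability and total mass 1 then carry over to every
    Gaussian weight. *)
Lemma gweight_normal_pdf k : 0 < k ->
  exists2 z : R, 0 < z &
    exists s : R, gweight k = (fun t => z * normal_pdf 0 s t).
Proof.
move=> k0; pose s := (Num.sqrt (2 * k))^-1.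
have s0 : s != 0 by rewrite invr_neq0 // sqrtr_eq0 -ltNge mulr_gt0.
have p0 := normal_peak_gt0 s0.
exists (normal_peak s)^-1; first by rewrite invr_gt0.
exists s; apply/funext => t; rewrite (gweight_normal_fun _ k0) normal_pdfE //.
by rewrite mulKf // gt_eqF.
Qed.

Lemma integrable_gweight k : 0 < k -> mu.-integrable setT (EFin \o gweight k).
Proof.
move=> /gweight_normal_pdf [z z0 [s ->]].
have -> : EFin \o (fun t => z * normal_pdf 0 s t) =
    (fun t => z%:E * (normal_pdf 0 s t)%:E)%E by apply/funext => t.
apply: integrableZl => //; exact: integrable_normal_pdf.
Qed.

Lemma Rintegral_gweight_gt0 k : 0 < k -> 0 < \int[mu]_t gweight k t.
Proof.
move=> /gweight_normal_pdf [z z0 [s ->]].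
rewrite RintegralZl //; last exact: integrable_normal_pdf.
by rewrite /Rintegral integral_normal_pdf mulr1.
Qed.

(** Induction on [q] for all [k] at once: half of the exponent absorbs the shorter polynomial, the
    other half absorbs the new factor [t]. *)
Lemma horner_le_gweight q k : 0 < k ->
  exists2 C : R, 0 <= C & forall t, `|q.[t]| * gweight k t <= C.
Proof.
elim/poly_ind: q k => [|q a IH] k k0.
  by exists 0 => // t; rewrite horner0 normr0 mul0r.
have k20 : 0 < k / 2 by rewrite divr_gt0.
have [C C0 HC] := IH _ k20.
exists (C * (1 + (k / 2)^-1) + `|a|); first by rewrite addr_ge0// mulr_ge0// addr_ge0// invr_ge0 ltW.
move=> t; have w1 (l : R) : 0 < l -> gweight l t <= 1.
  by move=> l0; rewrite /gweight expR_le1 oppr_le0 mulr_ge0 ?sqr_ge0// ltW.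
rewrite hornerMXaddC.
apply: (@le_trans _ _ (`|q.[t] * t| * gweight k t + `|a| * gweight k t)).
  by rewrite -mulrDl ler_wpM2r ?gweight_ge0 ?ler_normD.
apply: lerD; last by rewrite ler_piMr ?w1.
have -> : k = k / 2 + k / 2 by lra.
rewrite -gweightD normrM.
have -> : `|q.[t]| * `|t| * (gweight (k / 2) t * gweight (k / 2) t) =
  (`|q.[t]| * gweight (k / 2) t) * (`|t| * gweight (k / 2) t) by ring.
have -> : k / 2 + k / 2 = k by lra.
apply: ler_pM => //; rewrite ?mulr_ge0 ?gweight_ge0//.
(* With [d = k / 2]: [|t| <= 1 + t^2 <= (1 + 1/d) (1 + d t^2)], and the last factor is at most
   [expR (d t^2)]. *)
have h : `|t| <= (1 + (k / 2)^-1) * expR (k / 2 * t ^+ 2).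
  have e1 : 1 + (k / 2) * t ^+ 2 <= expR (k / 2 * t ^+ 2) by exact: expR_ge1Dx.
  have t1 : `|t| <= 1 + t ^+ 2.
    by rewrite -(real_normK (num_real t)); have := sqr_ge0 (`|t| - 1); have := normr_ge0 t; nra.
  apply: (le_trans t1).
  apply: (@le_trans _ _ ((1 + (k / 2)^-1) * (1 + k / 2 * t ^+ 2))); last first.
    by rewrite ler_wpM2l // addr_ge0// invr_ge0 ltW.
  have -> : (1 + (k / 2)^-1) * (1 + k / 2 * t ^+ 2) =
    1 + t ^+ 2 + ((k / 2)^-1 + k / 2 * t ^+ 2).
    by field; rewrite gt_eqF.
  by rewrite lerDl addr_ge0 // ?invr_ge0 ?(mulr_ge0 _ (sqr_ge0 t)) // ltW.
by rewrite /gweight expRN ler_pdivrMr ?expR_gt0.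
Qed.

(** Half of the Gaussian bounds the polynomial and the other half is kept, which serves both as an
    integrable majorant and for decay at infinity. *)
Lemma horner_gweight_decay q k : 0 < k ->
  exists C : R, forall t, `|q.[t] * gweight k t| <= C * gweight (k / 2) t.
Proof.
move=> k0; have k20 : 0 < k / 2 by rewrite divr_gt0.
have [C C0 HC] := horner_le_gweight q _ k20.
exists C => t; rewrite normrM (ger0_norm (gweight_ge0 _ _)).
have {1}-> : k = k / 2 + k / 2 by lra.
by rewrite -gweightD mulrA ler_wpM2r ?gweight_ge0.
Qed.

Lemma integrable_horner_gweight q k (g : R -> R) (B : R) :
  0 < k -> continuous g -> (forall t, `|g t| <= B) ->
  mu.-integrable setT (EFin \o (fun t => q.[t] * gweight k t * g t)).
Proof.
move=> k0 cg gB; have [C HC] := horner_gweight_decay q _ k0.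
have k20 : 0 < k / 2 by rewrite divr_gt0.
apply: (@le_integrable _ _ _ mu setT measurableT _
  (fun t => (C * B)%:E * (EFin \o gweight (k / 2)) t)%E).
- apply/measurable_EFinP; apply: continuous_measurable_fun => t.
  apply: cvgM; last exact: cg.
  by apply: cvgM; [exact: continuous_horner|exact: continuous_gweight].
- move=> t _; rewrite /= lee_fin normrM.
  apply: le_trans (ler_norm _).
  rewrite mulrAC; apply: ler_pM => //.
- by apply: integrableZl => //; exact: integrable_gweight.
Qed.

Lemma gweight_cvg0 k : 0 < k -> gweight k n%:R @[n --> \oo] --> (0 : R).
Proof.
move=> k0.
apply: (@squeeze_cvgr _ _ _ _ (cst 0) (fun n : nat => (k^-1) / n%:R)); last 2 first.
- exact: cvg_cst.
- rewrite -[X in _ --> X](mulr0 k^-1); apply: cvgM; first exact: cvg_cst.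
  by rewrite -(cvg_shiftS (fun n : nat => n%:R^-1 : R)); exact: cvg_harmonic.
near=> n; rewrite gweight_ge0 /=.
have n0 : (0 < n)%N by near: n; exists 1%N.
have n1 : 0 < n%:R :> R by rewrite ltr0n.
rewrite /gweight expRN -invfM lef_pV2 ?posrE ?expR_gt0 ?mulr_gt0//.
apply: le_trans (expR_ge1Dx _); have n2 : n%:R <= n%:R ^+ 2 :> R by rewrite expr2 ler_peMl ?ler1n ?ltW.
by have : k * n%:R <= k * n%:R ^+ 2 by [rewrite ler_pM2l]; lra.
Unshelve. all: by end_near. Qed.

Lemma horner_gweight_cvg0 q k (g : R -> R) (B : R) :
  0 < k -> (forall t, `|g t| <= B) ->
  q.[n%:R] * gweight k n%:R * g n%:R @[n --> \oo] --> (0 : R).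
Proof.
move=> k0 gB; have [C HC] := horner_gweight_decay q _ k0.
apply/norm_cvg0P.
apply: (@squeeze_cvgr _ _ _ _ (cst 0) (fun n : nat => C * B * gweight (k / 2) n%:R)).
- near=> n; rewrite normr_ge0 /= normrM mulrAC.
  by apply: ler_pM.
- exact: cvg_cst.
- rewrite -[X in _ --> X](mulr0 (C * B)); apply: cvgM; first exact: cvg_cst.
  by apply: gweight_cvg0; rewrite divr_gt0.
Unshelve. all: by end_near. Qed.

(** The derivative of [q * gweight k * g] integrates to zero, and differentiating the weight brings
    down [- 2 k t]. *)
Lemma Rintegral_horner_gweight_by_parts q k (g g' : R -> R) (B B' : R) :
  0 < k -> (forall t, is_derive t 1 g (g' t)) -> continuous g' ->
  (forall t, `|g t| <= B) -> (forall t, `|g' t| <= B') ->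
  \int[mu]_t (q^`().[t] * gweight k t * g t) + \int[mu]_t (q.[t] * gweight k t * g' t)
  = 2 * k * \int[mu]_t (('X * q).[t] * gweight k t * g t).
Proof.
move=> k0 dg cg' gB gB'.
have cg : continuous g.
  move=> t; apply: differentiable_continuous; apply/derivable1_diffP.
  by case: (dg t).
have i1 := integrable_horner_gweight q^`() _ _ _ k0 cg gB.
have i2 := integrable_horner_gweight q _ _ _ k0 cg' gB'.
have i3 := integrable_horner_gweight ('X * q) _ _ _ k0 cg gB.
have i12 := integrableD measurableT i1 i2.
have i3' : mu.-integrable setT (EFin \o (fun t => 2 * k * (('X * q).[t] * gweight k t * g t))).
  have := integrableZl measurableT (2 * k) i3.
  by apply: eq_integrable => // t _; rewrite /= EFinM.
apply/eqP; rewrite -subr_eq0 -RintegralZl // -RintegralD // -RintegralB //; apply/eqP.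
apply: (@Rintegral_derive_eq0 (fun t => q.[t] * gweight k t * g t)).
- move=> t; have dw := is_derive_gweight k t; have dgt := dg t.
  apply: is_derive_eq; rewrite /GRing.scale /= hornerM hornerX; ring.
- move=> t; apply: cvgB; first apply: cvgD.
  + apply: cvgM; last exact: cg.
    by apply: cvgM; [exact: continuous_horner|exact: continuous_gweight].
  + apply: cvgM; last exact: cg'.
    by apply: cvgM; [exact: continuous_horner|exact: continuous_gweight].
  + apply: cvgM; first exact: cvg_cst.
    apply: cvgM; last exact: cg.
    by apply: cvgM; [exact: continuous_horner|exact: continuous_gweight].
- have := integrableB measurableT i12 i3'.
  by apply: eq_integrable.
- exact: horner_gweight_cvg0 k0 gB.
(* The limit at minus infinity is the one at plus infinity for the reflected [q] and [g], since the
   weight is even. *)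
- have := @horner_gweight_cvg0 (q \Po (- 'X)) k (g \o -%R) B k0 (fun t => gB (- t)).
  by under eq_fun do rewrite horner_comp !hornerE /gweight -sqrrN.
Qed.

End GaussianMoments.

(** * Fourier integrals of polynomials against a Gaussian *)

Section GaussianFourier.
Context {R : realType}.
Implicit Types (k c t : R) (q : {poly R}).
Local Notation mu := (@lebesgue_measure R).

(** This is the integral of [q(t) exp(- k t^2) exp(- i c t)], split into real and imaginary
    parts. *)
Definition gfourier k c q : R[i] :=
  (\int[mu]_t (q.[t] * gweight k t * cos (c * t))) -i*
  (\int[mu]_t (q.[t] * gweight k t * sin (c * t))).

Lemma is_derive_cosM c t : is_derive t 1 (fun x => cos (c * x)) (- c * sin (c * t)).
Proof.
have h : is_derive t 1 (fun x : R => c * x) c.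
  by apply: is_derive_eq; rewrite /GRing.scale /=; ring.
by apply: is_derive_eq; rewrite /GRing.scale /=; ring.
Qed.

Lemma is_derive_sinM c t : is_derive t 1 (fun x => sin (c * x)) (c * cos (c * t)).
Proof.
have h : is_derive t 1 (fun x : R => c * x) c.
  by apply: is_derive_eq; rewrite /GRing.scale /=; ring.
by apply: is_derive_eq; rewrite /GRing.scale /=; ring.
Qed.

Lemma continuous_cosM c : continuous (fun x : R => cos (c * x)).
Proof.
move=> t; apply: differentiable_continuous; apply/derivable1_diffP.
by case: (is_derive_cosM c t).
Qed.

Lemma continuous_sinM c : continuous (fun x : R => sin (c * x)).
Proof.
move=> t; apply: differentiable_continuous; apply/derivable1_diffP.
by case: (is_derive_sinM c t).
Qed.

Let icos k c q (k0 : 0 < k) := @integrable_horner_gweight R q k _ 1 k0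
  (continuous_cosM c) (fun t => cos_max (c * t)).
Let isin k c q (k0 : 0 < k) := @integrable_horner_gweight R q k _ 1 k0
  (continuous_sinM c) (fun t => sin_max (c * t)).

Lemma gfourierD k c p q : 0 < k ->
  gfourier k c (p + q) = gfourier k c p + gfourier k c q.
Proof.
move=> k0; rewrite /gfourier; apply/eqP; rewrite eq_complex /=.
rewrite -opprD -!RintegralD //; try exact: icos; try exact: isin.
by apply/andP; split; apply/eqP; [|congr (- _)]; apply: eq_Rintegral => t _;
  rewrite hornerD; ring.
Qed.

Lemma gfourierZ k c a q : 0 < k ->
  gfourier k c (a *: q) = a%:C * gfourier k c q.
Proof.
move=> k0; rewrite /gfourier; apply/eqP; rewrite eq_complex /= !mul0r subr0 addr0 mulrN.
rewrite -!RintegralZl //; try exact: icos; try exact: isin.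
by apply/andP; split; apply/eqP; [|congr (- _)]; apply: eq_Rintegral => t _;
  rewrite hornerZ; ring.
Qed.

(** Integration by parts with [g] the cosine and then the sine: the derivative moves to the weight,
    giving [2 k 'X], and to the phase, giving [i c]. *)
Lemma gfourier_deriv k c q : 0 < k ->
  gfourier k c q^`() = (2 * k)%:C * gfourier k c ('X * q) + (0 +i* c) * gfourier k c q.
Proof.
move=> k0.
have bM (f : R -> R) (a : R) : (forall t, `|f t| <= 1) -> forall t, `|a * f t| <= `|a|.
  by move=> f1 t; rewrite normrM ler_piMr.
have cM (f : R -> R) (a : R) : continuous f -> continuous (fun t => a * f t).
  by move=> cf t; apply: cvgM; [exact: cvg_cst|exact: cf].
have hc := @Rintegral_horner_gweight_by_parts R q k _ _ 1 `|- c| k0 (is_derive_cosM c)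
  (cM _ (- c) (continuous_sinM c)) (fun t => cos_max (c * t))
  (bM (fun t => sin (c * t)) (- c) (fun t => sin_max (c * t))).
have hs := @Rintegral_horner_gweight_by_parts R q k _ _ 1 `|c| k0 (is_derive_sinM c)
  (cM _ c (continuous_cosM c)) (fun t => sin_max (c * t))
  (bM (fun t => cos (c * t)) c (fun t => cos_max (c * t))).
have ec : \int[mu]_t (q.[t] * gweight k t * (- c * sin (c * t))) =
          - c * \int[mu]_t (q.[t] * gweight k t * sin (c * t)).
  rewrite -RintegralZl //; last exact: isin.
  by apply: eq_Rintegral => t _; ring.
have es : \int[mu]_t (q.[t] * gweight k t * (c * cos (c * t))) =
          c * \int[mu]_t (q.[t] * gweight k t * cos (c * t)).
  rewrite -RintegralZl //; last exact: icos.
  by apply: eq_Rintegral => t _; ring.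
rewrite ec in hc; rewrite es in hs.
apply/eqP; rewrite eq_complex /gfourier /=; apply/andP; split; apply/eqP.
  by move: hc; set A := Rintegral _ _ _; set B := Rintegral _ _ _; set D := Rintegral _ _ _; lra.
by move: hs; set A := Rintegral _ _ _; set B := Rintegral _ _ _; set D := Rintegral _ _ _; lra.
Qed.

Lemma norm_sin_le t : `|sin t| <= `|t|.
Proof.
have main (x : R) : 0 <= x -> `|sin x| <= x.
  move=> x0.
  have [|y _] := @MVT_segment R sin cos 0 x x0 (fun y _ => is_derive_sin y).
    by apply: continuous_subspaceT; exact: continuous_sin.
  rewrite sin0 !subr0 => ->; rewrite normrM (ger0_norm x0).
  by rewrite ler_piMl// cos_max.
have [t0|t0] := leP 0 t; first by rewrite (ger0_norm t0) main.
by rewrite -normrN -sinN -(normrN t) (ger0_norm (x := - t)) ?main ?oppr_ge0 ?ltW.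
Qed.

Lemma cos_ge_parabola t : 1 - t ^+ 2 / 2 <= cos t.
Proof.
have -> : cos t = 1 - 2 * sin (t / 2) ^+ 2.
  have {1}-> : t = (t / 2) *+ 2 by rewrite -mulr_natr; lra.
  by rewrite cos_mulr2n cos2sin2 mulr2n; lra.
have : sin (t / 2) ^+ 2 <= (t / 2) ^+ 2.
  rewrite -(real_normK (num_real (sin _))) -(real_normK (num_real (t / 2))).
  by rewrite ler_pXn2r ?nnegrE ?norm_sin_le.
by rewrite expr_div_n; lra.
Qed.

(** Stands in for the closed form of the transform. As [cos (c t) >= 1 - (c t)^2 / 2], the real part
    is at least [Z - c^2 D / 2], with [Z] the mass and [D] the second moment; by parts [Z = 2 k D],
    so the bound is [(2 k - c^2 / 2) D]. *)
Lemma Re_gfourier1_gt0 k c : 0 < k -> c ^+ 2 < 4 * k ->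
  0 < complex.Re (gfourier k c 1).
Proof.
move=> k0 ck; rewrite /gfourier /=.
pose Z := \int[mu]_t gweight k t.
have Z0 : 0 < Z by exact: Rintegral_gweight_gt0.
have d0 t : is_derive t 1 (cst 1 : R -> R) ((cst 0 : R -> R) t).
  exact: is_derive_cst.
have hB := @Rintegral_horner_gweight_by_parts R 'X k (cst 1) (cst 0) 1 0 k0 d0
   (fun t => cvg_cst _) (fun t => _) (fun t => _).
have {}hB : Z = 2 * k * \int[mu]_t (('X * 'X).[t] * gweight k t * 1).
  rewrite -hB; [|by move=> t /=; rewrite normr1|by move=> t /=; rewrite normr0].
  rewrite [X in _ + X](_ : _ = 0); last first.
    under eq_Rintegral do rewrite mulr0.
    by rewrite Rintegral_cst // mul0r.
  rewrite addr0; apply: eq_Rintegral => t _.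
  by rewrite derivX hornerC mul1r mulr1.
have I2 : mu.-integrable setT (EFin \o (fun t => ('X * 'X).[t] * gweight k t * 1)).
  apply: (@integrable_horner_gweight R _ k (cst 1) 1 k0) => t; first exact: cvg_cst.
  by rewrite normr1.
have I0 := @integrable_gweight R k k0.
have I2' : mu.-integrable setT (EFin \o (fun t => c ^+ 2 / 2 * (('X * 'X).[t] * gweight k t * 1))).
  have := integrableZl measurableT (c ^+ 2 / 2) I2.
  by apply: eq_integrable => // t _; rewrite /= EFinM.
have := icos k c 1 k0 => I1.
apply: (@lt_le_trans _ _ (\int[mu]_t (gweight k t - c ^+ 2 / 2 * (('X * 'X).[t] * gweight k t * 1)))).
  rewrite RintegralB // RintegralZl // -/Z.
  move: hB; set D := Rintegral _ _ _ => hB.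
  have D0 : 0 < D by move: Z0; rewrite hB !pmulr_rgt0.
  rewrite hB -mulrBl mulr_gt0 //; lra.
apply: le_Rintegral => //.
- have := integrableB measurableT I0 I2'.
  by apply: eq_integrable.
- move=> t _.
  have -> : gweight k t - c ^+ 2 / 2 * (('X * 'X).[t] * gweight k t * 1) =
            gweight k t * (1 - (c * t) ^+ 2 / 2).
    by rewrite hornerM hornerX; ring.
  by rewrite hornerC mul1r ler_wpM2l ?gweight_ge0 ?cos_ge_parabola.
Qed.

End GaussianFourier.

(** * Hermite polynomials and the Wigner transform *)

Section ItoHermite.
Context {A : comNzRingType}.
Implicit Types a b : A.

(** Normalised so that the exponential generating function of [ito] is
    [exp (2 a s + 2 b t - 2 s t)]. For [j > m] the truncated [m - j] is harmless because the
    binomial vanishes. *)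
Definition ito_term n m j a b : A :=
  ('C(n, j) * 'C(m, j) * j`!)%:R * (-2) ^+ j * (2 * a) ^+ (n - j) * (2 * b) ^+ (m - j).

Definition ito n m a b : A := \sum_(j < n.+1) ito_term n m j a b.

Lemma ito0m m a b : ito 0 m a b = (2 * b) ^+ m.
Proof.
by rewrite /ito big_ord_recl big_ord0 addr0 /ito_term !bin0 !subn0 fact0 expr0 !mulr1 mul1r.
Qed.

(** Pascal's rule in [n] splits each term; the part with ['C(n, i)] lowers [m] through
    [(i+1) 'C(m, i+1) = m 'C(m-1, i)]. At [m = 0] the default [m.-1 = 0] has coefficient zero. *)
Lemma itoSn n m a b :
  ito n.+1 m a b = 2 * a * ito n m a b - (2 * m)%:R * ito n m.-1 a b.
Proof.
rewrite /ito big_ord_recl /= /ito_term !bin0 !subn0 expr0 mulr1.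
have E (i : 'I_n.+1) : ito_term n.+1 m (lift ord0 i) a b =
   ('C(n, i.+1) * 'C(m, i.+1) * i.+1`!)%:R * (-2) ^+ i.+1 * (2 * a) ^+ (n - i) * (2 * b) ^+ (m - i.+1)
   - (2 * m)%:R * ito_term n m.-1 i a b.
  rewrite /ito_term /= /bump /= add1n binS subSS.
  case: m => [|m] /=; first by rewrite bin0n /= !(muln0, mul0n, mul0r, addr0, subr0, mulr0n).
  rewrite subSS.
  have e : (i.+1 * 'C(m.+1, i.+1) = m.+1 * 'C(m, i))%N by rewrite mul_bin_diag.
  have e2 : (('C(n, i.+1) + 'C(n, i)) * 'C(m.+1, i.+1) * i.+1`! =
     'C(n, i.+1) * 'C(m.+1, i.+1) * i.+1`! + m.+1 * ('C(n, i) * 'C(m, i) * i`!))%N.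
    rewrite factS !mulnDl; congr addn.
    transitivity ('C(n, i) * (i.+1 * 'C(m.+1, i.+1)) * i`!)%N; first by lia.
    by rewrite e; lia.
  rewrite e2 natrD !(natrM _ m.+1) (natrM _ 2) ![(-2) ^+ i.+1]exprS.
  set u := (_ * _)%:R; set v := (_ * _)%:R; set r := (-2) ^+ i.
  ring.
rewrite (eq_bigr _ (fun i _ => E i)) sumrB -mulr_sumr addrA; congr (_ - _).
rewrite [in RHS]big_ord_recl /= !bin0 !subn0 expr0 mulr1 mulrDr.
congr (_ + _); first by rewrite exprS; ring.
rewrite big_ord_recr /= bin_small // !mul0n !mul0r addr0 mulr_sumr.
apply: eq_bigr => i _; rewrite /bump /= add1n.
by rewrite (_ : (n - i = (n - i.+1).+1)%N) ?exprS; [ring|have := ltn_ord i; lia].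
Qed.

(** Lets the Gaussian integrals be identified from their ladder recurrences alone: row 0 is
    geometric, and each further row is determined by the previous one. *)
Lemma ito_unique (F : nat -> nat -> A) a b :
  (forall m, F 0 m.+1 = 2 * b * F 0 m) ->
  (forall n m, F n.+1 m = 2 * a * F n m - (2 * m)%:R * F n m.-1) ->
  forall n m, F n m = F 0 0 * ito n m a b.
Proof.
move=> F0 FS; elim=> [|n IH] m; last by rewrite FS !IH itoSn; ring.
by rewrite ito0m; elim: m => [|m IHm]; rewrite ?mulr1 // F0 IHm exprS; ring.
Qed.

End ItoHermite.

Section HermitePoly.
Context {R : realType}.

Fixpoint hermp (n : nat) : {poly R} :=
  if n is n'.+1 then 2%:P * 'X * hermp n' - deriv (hermp n') else 1.

Lemma deriv_hermp n : deriv (hermp n) = (2 * n)%:R *: hermp n.-1.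
Proof.
elim: n => [|n IH]; first by rewrite /= derivC muln0 scale0r.
rewrite [in LHS]/= derivB IH !derivM derivX derivC IH derivZ.
case: n IH => [|n] IH; rewrite -!mul_polyC.
  by rewrite !muln0 /= derivC; ring.
rewrite [n.+1.-1]/= [n.+2.-1]/= [hermp n.+1]/= !rmorph_nat !natrM -!natr1; ring.
Qed.

Lemma hermiteH_hermp n (x : R) : hermiteH n x = (hermp n).[x].
Proof.
have E : derive1n n (fun y : R => expR (- y ^+ 2)) =
    fun x => (-1) ^+ n * ((hermp n).[x] * gweight 1 x).
  elim: n => [|n IH].
    by rewrite derive1n0; apply/funext => y; rewrite expr0 hornerC !mul1r /gweight mul1r.
  rewrite derive1nS IH; apply/funext => y; rewrite derive1E.
  apply: derive_val.
  have dw := is_derive_gweight 1 y.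
  apply: is_derive_eq; rewrite /GRing.scale /= exprS !(hornerD, hornerN, hornerM, hornerC, hornerX).
  set h := (hermp n).[y]; set h' := _.[y]; set w := gweight _ _; set s := _ ^+ n.
  ring.
rewrite /hermiteH E /gweight mul1r expRN.
by rewrite mulrACA -expr2 sqrr_sign mul1r mulrCA divff ?mulr1 // gt_eqF // expR_gt0.
Qed.

Variables (l x c : R).
Hypothesis l0 : 0 < l.

(** [F] and [G] are the two Hermite factors of the Wigner integrand as polynomials in the
    integration variable; [l] will be [1 / (2 sqrt hbar)], so that [k = l^2] is the rate of the
    combined Gaussian. *)
Let F n : {poly R} := hermp n \Po (x%:P + l *: 'X).
Let G n : {poly R} := hermp n \Po (x%:P - l *: 'X).
Let k := l ^+ 2.
Let k0 : 0 < k. Proof. by rewrite exprn_gt0. Qed.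

Let derivG n : deriv (G n) = - ((2 * n)%:R * l) *: G n.-1.
Proof.
rewrite /G deriv_comp deriv_hermp derivB derivC derivZ derivX sub0r comp_polyZ.
by rewrite -!mul_polyC !rmorphN !rmorphM /= mulr1; ring.
Qed.

(** The rule [H_(n+1) = 2 x H_n - H_n'] at the shifted argument; the factor [l] turns [H_n'] into a
    derivative in the integration variable, with the opposite sign for [G]. *)
Let FS n : l *: F n.+1 = (2 * l * x) *: F n + (2 * k) *: ('X * F n) - deriv (F n).
Proof.
rewrite /F /= comp_polyB !comp_polyM comp_polyX comp_polyC deriv_comp.
rewrite derivD derivC derivZ derivX add0r -!mul_polyC /k !rmorphM /= mulr1.
ring.
Qed.

Let GS n : l *: G n.+1 = (2 * l * x) *: G n - (2 * k) *: ('X * G n) + deriv (G n).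
Proof.
rewrite /G /= comp_polyB !comp_polyM comp_polyX comp_polyC deriv_comp.
rewrite derivB derivC derivZ derivX sub0r -!mul_polyC /k !rmorphM /= mulr1.
ring.
Qed.

Let Phi := gfourier k c.
Let PhiD p q : Phi (p + q) = Phi p + Phi q. Proof. exact: gfourierD. Qed.
Let PhiZ a q : Phi (a *: q) = a%:C * Phi q. Proof. exact: gfourierZ. Qed.
Let PhiN q : Phi (- q) = - Phi q.
Proof. by rewrite -scaleN1r PhiZ rmorphN rmorph1 mulN1r. Qed.
Let Phi_deriv q :
  Phi (deriv q) = (2 * k)%:C * Phi ('X * q) + (0 +i* c) * Phi q.
Proof. exact: gfourier_deriv. Qed.

Lemma gfourier_hermp n m :
  gfourier k c ((hermp n \Po (x%:P + l *: 'X)) * (hermp m \Po (x%:P - l *: 'X))) =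
  gfourier k c 1 * ito n m (x -i* (c / (2 * l))) (x +i* (c / (2 * l))).
Proof.
have lC0 : l%:C != 0 :> R[i] by rewrite fmorph_eq0 gt_eqF.
have F0 : F 0 = 1 by rewrite /F /= comp_polyC.
have G0 : G 0 = 1 by rewrite /G /= comp_polyC.
(* After integration by parts the terms in ['X] cancel, and the multipliers [2 l x - i c] for [F]
   and [2 l x + i c] for [G] remain. *)
have pm : l%:C * (2 * (x -i* (c / (2 * l)))) = (2 * l * x)%:C - (0 +i* c).
  by simpc; congr (_ +i* _); field; rewrite ?gt_eqF.
have pp : l%:C * (2 * (x +i* (c / (2 * l)))) = (2 * l * x)%:C + (0 +i* c).
  by simpc; congr (_ +i* _); field; rewrite ?gt_eqF.
suff H : forall n m, Phi (F n * G m) = Phi (F 0 * G 0) *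
    ito n m (x -i* (c / (2 * l))) (x +i* (c / (2 * l))).
  by have := H n m; rewrite F0 G0 mul1r.
apply: ito_unique => [m'|n' m']; apply: (mulfI lC0).
  rewrite F0 !mul1r mulrA pp -PhiZ GS !PhiD PhiN !PhiZ Phi_deriv; ring.
rewrite mulrBr mulrA pm -PhiZ scalerAl FS !(mulrDl, mulNr) !PhiD PhiN -!scalerAl !PhiZ.
(* The derivative is moved from [F n'] to [G m'], where it lowers the index [m']. *)
have := Phi_deriv (F n' * G m'); rewrite derivM PhiD derivG -scalerAr PhiZ mulrA.
move=> e; have -> : Phi (deriv (F n') * G m') =
   (2 * k)%:C * Phi ('X * F n' * G m') + (0 +i* c) * Phi (F n' * G m')
   - (- ((2 * m')%:R * l))%:C * Phi (F n' * G m'.-1) by rewrite -e addrK.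
rewrite rmorphN rmorphM /= rmorph_nat; ring.
Qed.

End HermitePoly.

Lemma conjCc (R : rcfType) (z : R[i]) : z^*%R = conjc z.
Proof. by []. Qed.

Section WignerHermite.
Context {R : realType} (hbar : R).
Hypothesis hbar0 : 0 < hbar.
Local Notation mu := (@lebesgue_measure R).

Definition hermite_norm n : R := (Num.sqrt (2 ^+ n * (n`!)%:R))^-1.

Lemma hermite_norm_gt0 n : 0 < hermite_norm n.
Proof. by rewrite invr_gt0 sqrtr_gt0 mulr_gt0 ?exprn_gt0 // ltr0n fact_gt0. Qed.

Definition wigner_prefactor (x p : R) : R[i] :=
  ((2 * pi * hbar)^-1 * (Num.sqrt (Num.sqrt (pi * hbar)))^-1 ^+ 2 *
    expR (- (x ^+ 2 / hbar)))%:C * gfourier ((2 * Num.sqrt hbar)^-1 ^+ 2) (p / hbar) 1.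

(** For frequency [c = p / hbar] and rate [k = 1 / (4 hbar)], the condition [c^2 < 4 k] reads
    [p^2 < hbar]. *)
Lemma wigner_prefactor_neq0 x p : p ^+ 2 < hbar -> wigner_prefactor x p != 0.
Proof.
move=> ph; rewrite /wigner_prefactor mulf_neq0 //.
  rewrite fmorph_eq0 gt_eqF // mulr_gt0 ?expR_gt0 // mulr_gt0 //.
    by rewrite invr_gt0 !mulr_gt0 ?pi_gt0.
  by rewrite exprn_gt0 // invr_gt0 !sqrtr_gt0 mulr_gt0 ?pi_gt0.
apply/eqP => e; have := @Re_gfourier1_gt0 R ((2 * Num.sqrt hbar)^-1 ^+ 2) (p / hbar).
rewrite e /= ltxx => h; apply: (notF (h _ _)).
  by rewrite exprn_gt0 // invr_gt0 mulr_gt0 ?sqrtr_gt0.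
rewrite expr_div_n exprVn exprMn sqr_sqrtr ?ltW // expr2 ltr_pdivrMr ?mulr_gt0 //.
rewrite [X in _ < X](_ : _ = hbar) //; field.
by rewrite gt_eqF.
Qed.

Lemma wigner_hermite n m x p :
  wigner hbar (hermite_fun hbar n) (hermite_fun hbar m) x p =
  wigner_prefactor x p * (hermite_norm n * hermite_norm m)%:C *
  ito n m ((x / Num.sqrt hbar) -i* (p / Num.sqrt hbar))
             ((x / Num.sqrt hbar) +i* (p / Num.sqrt hbar)).
Proof.
pose r := Num.sqrt hbar; have r0 : 0 < r by rewrite sqrtr_gt0.
have rr : r ^+ 2 = hbar by rewrite sqr_sqrtr // ltW.
pose l := (2 * r)^-1; have l0 : 0 < l by rewrite invr_gt0 mulr_gt0.
have := @gfourier_hermp R l (x / r) (p / hbar) l0 n m.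
have -> : p / hbar / (2 * l) = p / r.
  by rewrite -rr /l; field; rewrite gt_eqF.
rewrite -/r; set T := ito _ _ _ _; set q := (_ \Po _) * _ => E.
pose a := (Num.sqrt (Num.sqrt (pi * hbar)))^-1 ^+ 2 * expR (- (x ^+ 2 / hbar)) *
   (hermite_norm n * hermite_norm m).
have k0 : 0 < l ^+ 2 by rewrite exprn_gt0.
have -> : wigner hbar (hermite_fun hbar n) (hermite_fun hbar m) x p =
    ((2 * pi * hbar)^-1 * a)%:C * gfourier (l ^+ 2) (p / hbar) q.
  rewrite /wigner rmorphM -[RHS]mulrA; congr (_ * _).
  rewrite -gfourierZ // /cintegral /gfourier.
  have P t : hermite_fun hbar n (x + t / 2) * (hermite_fun hbar m (x - t / 2))^* =
      ((a *: q).[t] * gweight (l ^+ 2) t)%:C.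
    rewrite /hermite_fun -!/(hermite_norm _) !hermiteH_hermp conjCc conjc_real -rmorphM /=.
    congr (_%:C).
    rewrite /a /q hornerZ hornerM !horner_comp !(hornerD, hornerN, hornerZ, hornerX, hornerC) /gweight.
    have -> : (x + t / 2) / Num.sqrt hbar = x / r + l * t.
      by rewrite -/r /l; field; rewrite gt_eqF.
    have -> : (x - t / 2) / Num.sqrt hbar = x / r - l * t.
      by rewrite -/r /l; field; rewrite gt_eqF.
    (* The parallelogram identity [(x + t/2)^2 + (x - t/2)^2 = 2 x^2 + t^2 / 2] separates [x] from
       [t]. *)
    have e : expR (- (x + t / 2) ^+ 2 / (2 * hbar)) * expR (- (x - t / 2) ^+ 2 / (2 * hbar))
      = expR (- (x ^+ 2 / hbar)) * expR (- (l ^+ 2 * t ^+ 2)).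
      rewrite -!expRD; congr expR; rewrite /l -rr; field; by rewrite gt_eqF.
    set E1 := expR _ in e *; set E2 := expR _ in e *; set E3 := expR _ in e *; set E4 := expR _ in e *.
    set s := (Num.sqrt (Num.sqrt _))^-1.
    set h1 := (hermp n).[_]; set h2 := (hermp m).[_].
    transitivity (s ^+ 2 * hermite_norm n * hermite_norm m * h1 * h2 * (E1 * E2)); first by ring.
    by rewrite e; ring.
  congr (_ +i* _); last first.
    rewrite -[RHS]mulN1r -RintegralZl //; last first.
      exact: (@integrable_horner_gweight R _ _ _ 1 k0 (continuous_sinM _) (fun t => sin_max _)).
    apply: eq_Rintegral => t _; rewrite P /cexpm /= mul0r addr0.
    by rewrite (_ : p * t / hbar = p / hbar * t); ring.
  apply: eq_Rintegral => t _; rewrite P /cexpm /= mul0r subr0.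
  by rewrite (_ : p * t / hbar = p / hbar * t); ring.
rewrite E /wigner_prefactor -/r -/l /a !rmorphM /=; ring.
Qed.

End WignerHermite.

(** * Laurent polynomials on the circle *)

Lemma poly_eq0_infinite_roots (D : idomainType) (q : {poly D}) (u : nat -> D) :
  injective u -> (forall i, root q (u i)) -> q = 0.
Proof.
move=> ui qu; apply/eqP/contraT => q0.
have := @max_poly_roots _ q (map u (iota 0 (size q))) q0.
rewrite size_map size_iota ltnn; apply.
  by apply/allP => _ /mapP[i _ ->]; exact: qu.
by rewrite map_inj_uniq // iota_uniq.
Qed.

Section LaurentPoly.
Context {C : fieldType}.
Implicit Types (s : {poly C}).

Lemma coefM_top (p q : {poly C}) d e :
  (size p <= d.+1)%N -> (size q <= e.+1)%N -> (p * q)`_(d + e) = p`_d * q`_e.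
Proof.
move=> sp sq; rewrite coefM.
have dlt : (d < (d + e).+1)%N by rewrite ltnS leq_addr.
rewrite (bigD1 (Ordinal dlt)) //= addKn big1 ?addr0 // => i /eqP ni.
have [id|id] := ltnP d i; first by rewrite nth_default ?mul0r // (leq_trans sp).
rewrite mulrC nth_default ?mul0r // (leq_trans sq) //.
suff : (i < d)%N by lia.
rewrite ltn_neqAle id andbT; apply/eqP => idd; apply: ni; exact: val_inj.
Qed.

Lemma coef_exp_top s i d : (size s <= d.+1)%N ->
  (size (s ^+ i) <= (i * d).+1)%N /\ (s ^+ i)`_(i * d) = s`_d ^+ i.
Proof.
move=> ss; elim: i => [|i [IH1 IH2]].
  by rewrite expr0 size_poly1 coef1 eqxx.
rewrite !exprS mulSn; split; last by rewrite coefM_top // IH2.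
rewrite (leq_trans (size_polyMleq _ _)) //; lia.
Qed.

(* The factor ['X^(N - i)] clears denominators uniformly: [s.[u] ^+ i] stands
   for [u ^+ i] times the [i]-th power of a Laurent polynomial. *)
Definition shiftp N i s : {poly C} := 'X^(N - i) * s ^+ i.

(** The degree is at most [(N - i) + 2 i = N + i], which reaches [2 N] only for [i = N]. *)
Lemma shiftp_top N i s : (size s <= 3)%N -> (i <= N)%N ->
  (size (shiftp N i s) <= (2 * N).+1)%N /\
  (shiftp N i s)`_(2 * N) = if i == N then s`_2 ^+ N else 0.
Proof.
move=> ss iN; have [h1 h2] := @coef_exp_top s i 2 ss.
split.
  rewrite (leq_trans (size_polyMleq _ _)) // size_polyXn; lia.
rewrite coefXnM ltnNge (_ : (N - i <= 2 * N)%N) /=; last by lia.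
have [e|ne] := eqVneq i N; first by rewrite e subnn subn0 mulnC -e h2.
by rewrite nth_default // (leq_trans h1) //; lia.
Qed.

Lemma horner_shiftp N i s u v : (i <= N)%N -> s.[u] = u * v ->
  (shiftp N i s).[u] = u ^+ N * v ^+ i.
Proof.
move=> iN su; rewrite /shiftp hornerM hornerXn horner_exp su exprMn mulrA -exprD.
by rewrite subnK.
Qed.

Variables (B B' : nat -> C) (al be al' be' : C) (N : nat).

(* The conjugate coordinate [be' u + al' / u] and the coordinate
   [al u + be / u], both multiplied by [2 u] to clear the denominator. *)
Definition circle_conj : {poly C} := (2 * be') *: 'X^2 + (2 * al')%:P.
Definition circle_coord : {poly C} := (2 * al) *: 'X^2 + (2 * be)%:P.

(** For [n] and [m] up to [N], this is [ito n m] of the two coordinates times [u ^ (2 N)], a power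
    independent of [n] and [m], so that the double sum can be cleared at once. *)
Definition itop n m : {poly C} :=
  \sum_(j < n.+1) (('C(n, j) * 'C(m, j) * j`!)%:R * (-2) ^+ j) *:
     (shiftp N (n - j) circle_conj * shiftp N (m - j) circle_coord).

(** The primed data will be complex conjugates; keeping them independent makes the coefficient
    comparison purely algebraic. *)
Definition wignerp : {poly C} :=
  \sum_(n < N.+1) \sum_(m < N.+1) (B n * B' m) *: itop n m.

Lemma horner_wignerp u : u != 0 ->
  wignerp.[u] = u ^+ (N + N) * \sum_(n < N.+1) \sum_(m < N.+1)
    B n * B' m * ito n m (be' * u + al' / u) (al * u + be / u).
Proof.
move=> u0; rewrite /wignerp horner_sum mulr_sumr; apply: eq_bigr => n _.
rewrite horner_sum mulr_sumr; apply: eq_bigr => m _.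
rewrite hornerZ mulrCA; congr (_ * _).
rewrite /itop horner_sum /ito mulr_sumr; apply: eq_bigr => j _.
have ea : circle_conj.[u] = u * (2 * (be' * u + al' / u)).
  by rewrite /circle_conj !(hornerD, hornerZ, hornerXn, hornerC); field.
have eb : circle_coord.[u] = u * (2 * (al * u + be / u)).
  by rewrite /circle_coord !(hornerD, hornerZ, hornerXn, hornerC); field.
have hn := ltn_ord n; have hm := ltn_ord m.
rewrite hornerZ hornerM (@horner_shiftp N _ _ u _ _ ea) ?(@horner_shiftp N _ _ u _ _ eb) /ito_term; [|lia..].
by rewrite exprD; ring.
Qed.

Hypothesis char0 : forall n, n.+1%:R != 0 :> C.

(** Only [n = m = N] with [j = 0] reaches degree [4 N], where the coefficient is
    [B N * B' N * (2 be') ^ N * (2 al) ^ N]. For [N = 0] this is nonzero, so that case is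
    contradictory. *)
Lemma wignerp_top : wignerp = 0 -> B N != 0 -> B' N != 0 -> al * be' = 0.
Proof.
move=> T0 BN B'N.
have ssa : (size circle_conj <= 3)%N.
  rewrite (leq_trans (size_polyD _ _)) // geq_max (leq_trans (size_scale_leq _ _)) ?size_polyXn //.
  by rewrite (leq_trans (size_polyC_leq1 _)).
have ssb : (size circle_coord <= 3)%N.
  rewrite (leq_trans (size_polyD _ _)) // geq_max (leq_trans (size_scale_leq _ _)) ?size_polyXn //.
  by rewrite (leq_trans (size_polyC_leq1 _)).
have sa2 : circle_conj`_2 = 2 * be' by rewrite /circle_conj coefD coefZ coefXn coefC /= mulr1 addr0.
have sb2 : circle_coord`_2 = 2 * al by rewrite /circle_coord coefD coefZ coefXn coefC /= mulr1 addr0.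
have ci n m : (n <= N)%N -> (m <= N)%N ->
    (itop n m)`_(2 * N + 2 * N) =
      if (n == N) && (m == N) then (2 * be') ^+ N * (2 * al) ^+ N else 0.
  move=> nN mN; rewrite /itop coef_sum.
  have E (j : 'I_n.+1) : ((('C(n, j) * 'C(m, j) * j`!)%:R * (-2) ^+ j) *:
     (shiftp N (n - j) circle_conj * shiftp N (m - j) circle_coord))`_(2 * N + 2 * N) =
     if (n == N) && (m == N) && (j == ord0) then (2 * be') ^+ N * (2 * al) ^+ N else 0.
    have [|a1 a2] := @shiftp_top N (n - j) circle_conj ssa; first by lia.
    have [|b1 b2] := @shiftp_top N (m - j) circle_coord ssb; first by lia.
    rewrite coefZ coefM_top // a2 b2 sa2 sb2 -val_eqE /=.
    have [j0|j0] := eqVneq (nat_of_ord j) 0%N.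
      rewrite j0 !subn0 !bin0 expr0 !mul1r andbT.
      by case: eqP; case: eqP; rewrite /= ?mulr0 ?mul0r.
    rewrite (_ : (n - j == N)%N = false) ?mul0r ?mulr0 ?andbF //.
    by apply/eqP; have := ltn_ord j; lia.
  rewrite (eq_bigr _ (fun j _ => E j)).
  case: ifP => h /=; last by rewrite big1.
  by rewrite -big_mkcond big_pred1_eq.
have : wignerp`_(2 * N + 2 * N) = B N * B' N * ((2 * be') ^+ N * (2 * al) ^+ N).
  rewrite /wignerp coef_sum big_ord_recr /= big1 ?add0r => [|n _]; last first.
    rewrite coef_sum big1 // => m _; rewrite coefZ ci ?(ltn_eqF (ltn_ord n)) ?mulr0 //.
      by have := ltn_ord n; lia.
    by have := ltn_ord m; lia.
  rewrite coef_sum big_ord_recr /= big1 ?add0r => [|m _]; last first.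
    rewrite coefZ ci ?(ltn_eqF (ltn_ord m)) ?andbF ?mulr0 //.
    by have := ltn_ord m; lia.
  by rewrite coefZ ci // eqxx.
rewrite T0 coef0 => /esym/eqP; rewrite !mulf_eq0 (negPf BN) (negPf B'N) /=.
rewrite !expf_eq0 !mulf_eq0 (negPf (char0 1)) /= => /orP[] /andP[_ /eqP ->]; rewrite ?mul0r ?mulr0 //.
Qed.

(** With [be = be' = 0] both coordinates are monomials, so [itop n m] is a multiple of
    [u ^ (2 N + m - n)]. Since [n <= N] and only [m >= M] counts, the exponent [N + M] forces
    [n = N] and [m = M]. *)
Lemma wignerp_low M : be = 0 -> be' = 0 -> wignerp = 0 ->
  B N != 0 -> B' M != 0 -> (M <= N)%N -> (forall m, (m < M)%N -> B' m = 0) ->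
  ito N M al' al = 0.
Proof.
move=> be0 be'0 T0 BN B'M MN lowM.
have ci n m : (n <= N)%N -> (m <= N)%N ->
    (itop n m)`_(N + M) = if (N + m == M + n)%N then ito n m al' al else 0.
  move=> nN mN; rewrite /itop coef_sum /ito.
  have -> : (if (N + m == M + n)%N then \sum_(j < n.+1) ito_term n m j al' al else 0) =
    \sum_(j < n.+1) if (N + m == M + n)%N then ito_term n m j al' al else 0.
    by case: ifP => // _; rewrite big1.
  apply: eq_bigr => j _; rewrite /ito_term.
  have [jm|jm] := leqP j m; last first.
    by rewrite (bin_small jm) muln0 mul0n !mul0r scale0r coef0 if_same.
  have jn : (j <= n)%N by rewrite -ltnS ltn_ord.
  have -> : shiftp N (n - j) circle_conj = (2 * al') ^+ (n - j) *: 'X^(N - (n - j)).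
    by rewrite /shiftp /circle_conj be'0 mulr0 scale0r add0r -polyC_exp mulrC mul_polyC.
  have -> : shiftp N (m - j) circle_coord = (2 * al) ^+ (m - j) *: 'X^(N + (m - j)).
    rewrite /shiftp /circle_coord be0 mulr0 addr0 exprZn -exprM -scalerAr -exprD.
    by congr (_ *: 'X^_); lia.
  rewrite -scalerAl -scalerAr -exprD !scalerA coefZ coefXn.
  have -> : (N + M == N - (n - j) + (N + (m - j)))%N = (N + m == M + n)%N.
    by apply/eqP/eqP; lia.
  by case: ifP => _; rewrite ?mulr0 ?mulr1.
have : wignerp`_(N + M) = B N * B' M * ito N M al' al.
  have MN' : (M < N.+1)%N by [].
  rewrite /wignerp coef_sum big_ord_recr /= big1 ?add0r => [|n _]; last first.
    have hn := ltn_ord n.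
    rewrite coef_sum big1 // => m _; have hm := ltn_ord m.
    rewrite coefZ ci; [|lia..].
    have [mM|mM] := ltnP m M; first by rewrite lowM // mulr0 mul0r.
    by rewrite (_ : (_ == _)%N = false) ?mulr0 //; apply/eqP; lia.
  rewrite coef_sum (bigD1 (Ordinal MN')) //= coefZ ci // (addnC M N) eqxx big1 ?addr0 // => m mM.
  have hm := ltn_ord m.
  rewrite coefZ ci //.
  rewrite (_ : (_ == _)%N = false) ?mulr0 //; apply/eqP => e; case/eqP: mM.
  by apply: val_inj => /=; lia.
by rewrite T0 coef0 => /esym/eqP; rewrite !mulf_eq0 (negPf BN) (negPf B'M) /= => /eqP.
Qed.

End LaurentPoly.

(** * Laguerre polynomials inside the complex Hermite polynomials *)

Section Laguerre.
Context {R : realType}.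

(** Reversing the sum by [j = m - i] pulls out [(2 a) ^ (n - m) * (-2) ^ m]; what is left of the
    powers is [(2 a * 2 b / (-2)) ^ i = (- 2 r) ^ i], hence the argument [2 r]. *)
Lemma ito_laguerre (a b : R[i]) (r : R) n m : (m <= n)%N -> a * b = r%:C ->
  ito n m a b =
  (2 * a) ^+ (n - m) * (m`!)%:R * (-2) ^+ m * (laguerre m (n - m) (2 * r))%:C.
Proof.
move=> mn ab; rewrite /ito /laguerre rmorph_sum mulr_sumr.
have -> : \sum_(j < n.+1) ito_term n m j a b = \sum_(j < m.+1) ito_term n m j a b.
  rewrite [RHS](big_ord_widen n.+1 (fun j => ito_term n m j a b)) // [RHS]big_mkcond /=.
  apply: eq_bigr => j _; case: ifPn => //; rewrite -leqNgt => jm.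
  by rewrite /ito_term (bin_small jm) muln0 mul0n !mul0r.
rewrite (reindex_inj rev_ord_inj) /=; apply: eq_bigr => i _.
have im : (i <= m)%N by rewrite -ltnS.
rewrite subSS /ito_term subKn // subnKC //.
rewrite bin_sub //.
have -> : (n - (m - i) = (n - m) + i)%N by lia.
have f0 : (i`!)%:R != 0 :> R[i] by rewrite pnatr_eq0 -lt0n fact_gt0.
have fm : (m`!)%:R = 'C(m, i)%:R * (i`!)%:R * ((m - i)`!)%:R :> R[i].
  by rewrite -!natrM -mulnA bin_fact.
have e2 : (-2) ^+ m = (-2) ^+ (m - i) * (-2) ^+ i :> R[i] by rewrite -exprD subnK.
rewrite fm e2 !rmorphM /= fmorphV !rmorph_nat !rmorphXn /= rmorphN rmorph1.
have -> : (2 * r)%:C = 2 * (a * b) by rewrite ab rmorphM rmorph_nat.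
rewrite exprD !exprMn (exprNn 2 i) (exprNn 1 i) expr1n mulr1.
have ss : (-1) ^+ i * (-1) ^+ i = 1 :> R[i] by rewrite -expr2 sqrr_sign.
set s := (-1) ^+ i in ss *; set d := (-2) ^+ _; set f := _ `! %:R in f0 *.
set x := (2 ^+ (n - m)); set y := a ^+ (n - m); set ai := a ^+ i; set bi := b ^+ i.
set t := 2 ^+ i.
transitivity ('C(n, m - i)%:R * 'C(m, i)%:R * ((m - i)`!)%:R * d * (x * y) * t * t * ai * bi * (s * s)).
  by rewrite ss; ring.
by field.
Qed.

Definition laguerrep n k : {poly R} :=
  \poly_(j < n.+1) ((-1) ^+ j * ('C(n + k, n - j))%:R / (j`!)%:R).

Lemma horner_laguerrep n k x : (laguerrep n k).[x] = laguerre n k x.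
Proof.
rewrite /laguerrep horner_poly /laguerre; apply: eq_bigr => j _; ring.
Qed.

(** The constant coefficient is the positive binomial ['C(n + k, n)]. *)
Lemma laguerrep_neq0 n k : laguerrep n k != 0.
Proof.
apply/negP => /eqP /(congr1 (fun q : {poly R} => q`_0)).
rewrite coef0 coef_poly /= expr0 mul1r fact0 divr1 subn0 => /eqP.
by rewrite pnatr_eq0 -leqn0 leqNgt bin_gt0 leq_addr.
Qed.

Lemma finite_roots_laguerre n k : finite_set [set x : R | laguerre n k x = 0].
Proof.
apply: contrapT => inf.
have [X XA sX] := infinite_set_fset (size (laguerrep n k)) inf.
have := @max_poly_roots _ (laguerrep n k) (finmap.enum_fset X) (laguerrep_neq0 n k).
move=> h; have := h _ (finmap.fset_uniq X).
rewrite ltnNge sX => h2; apply: notF (h2 _).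
apply/allP => x xX; rewrite /root horner_laguerrep.
by apply/eqP/(XA x).
Qed.

End Laguerre.

(** * Vanishing of a Hermite form on a circle *)

Lemma det_mx22 (A : comNzRingType) (S : 'M[A]_2) :
  \det S = S 0 0 * S 1 1 - S 0 1 * S 1 0.
Proof.
rewrite (expand_det_row _ ord0) !big_ord_recl big_ord0 addr0 /cofactor !det_mx11 !mxE /=.
have -> : lift ord0 0 = 1 :> 'I_2 by exact: val_inj.
have -> : lift 1 0 = 0 :> 'I_2 by exact: val_inj.
by rewrite /bump /= addn0 add0n; ring.
Qed.

Section Circle.
Context {R : realType} (hbar : R).
Hypothesis hbar0 : 0 < hbar.

Definition hermite_form N (b : nat -> R[i]) x p : R[i] :=
  \sum_(n < N.+1) \sum_(m < N.+1) b n * (b m)^* *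
    wigner hbar (hermite_fun hbar n) (hermite_fun hbar m) x p.

Lemma hermite_formE N b x p :
  hermite_form N b x p = wigner_prefactor hbar x p *
  \sum_(n < N.+1) \sum_(m < N.+1)
    (b n * (hermite_norm n)%:C) * (b m * (hermite_norm m)%:C)^* *
    ito n m ((x / Num.sqrt hbar) -i* (p / Num.sqrt hbar))
             ((x / Num.sqrt hbar) +i* (p / Num.sqrt hbar)).
Proof.
rewrite /hermite_form mulr_sumr; apply: eq_bigr => n _.
rewrite mulr_sumr; apply: eq_bigr => m _.
rewrite (@wigner_hermite R hbar hbar0) (rmorphM Num.conj) /= [Num.conj _%:C]conjCc conjc_real.
by rewrite rmorphM /=; ring.
Qed.

(** Zero coefficients at the top of the range are dropped, since the coefficient comparison needs a
    nonzero leading one. *)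
Lemma hermite_form_reduce N (b : nat -> R[i]) :
  (forall x p, hermite_form N b x p = 0) \/
  exists2 N', b N' != 0 & forall x p, hermite_form N b x p = hermite_form N' b x p.
Proof.
elim: N => [|N IH].
  have [b0|b0] := eqVneq (b 0%N) 0; last by right; exists 0%N.
  by left=> x p; rewrite /hermite_form !big_ord_recl !big_ord0 b0 !mul0r !addr0.
have [bN|bN] := eqVneq (b N.+1) 0; last by right; exists N.+1.
have E x p : hermite_form N.+1 b x p = hermite_form N b x p.
  rewrite /hermite_form big_ord_recr /= [X in _ + X]big1 ?addr0; last first.
    by move=> m _; rewrite bN !mul0r.
  apply: eq_bigr => n _; rewrite big_ord_recr /= bN.
  by rewrite (rmorph0 Num.conj) mulr0 mul0r addr0.
case: IH => [IH|[N' bN' IH]]; first by left=> x p; rewrite E.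
by right; exists N' => // x p; rewrite E.
Qed.

Lemma unit_complexE (u : R[i]) : u * u^* = 1 -> u^-1 = conjc u.
Proof.
move=> uu; have u0 : u != 0.
  by apply/eqP => u0; move: uu; rewrite u0 mul0r => /esym/eqP; rewrite oner_eq0.
by apply: (mulfI u0); rewrite divff // -uu.
Qed.

Lemma hermite_form_circle N (b : nat -> R[i]) (S : 'M[R]_2) Rad :
  \det S = 1 -> b N != 0 -> 0 < Rad ->
  (forall x p, x ^+ 2 + p ^+ 2 = Rad ^+ 2 ->
     hermite_form N b (mx_act S (x, p)).1 (mx_act S (x, p)).2 = 0) ->
  exists n k : nat, (0 < n)%N /\ laguerre n k (2 * (Rad ^+ 2 / hbar)) = 0.
Proof.
move=> detS bN Rad0 vanish.
pose r := Num.sqrt hbar; have r0 : 0 < r by rewrite sqrtr_gt0.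
have rr : r ^+ 2 = hbar by rewrite sqr_sqrtr // ltW.
pose rho := Rad / r; have rho0 : 0 < rho by rewrite divr_gt0.
have det2 : S 0 0 * S 1 1 - S 0 1 * S 1 0 = 1 by rewrite -detS det_mx22.
(* The complex-linear and antilinear parts of the real-linear map sending [u = x + i y] to the
   complex coordinate of [S (Rad x, Rad y) / r]. *)
pose al : R[i] := (rho / 2 * (S 0 0 + S 1 1)) +i* (rho / 2 * (S 1 0 - S 0 1)).
pose be : R[i] := (rho / 2 * (S 0 0 - S 1 1)) +i* (rho / 2 * (S 1 0 + S 0 1)).
pose B n := b n * (hermite_norm n)%:C.
pose T := wignerp B (fun n => (B n)^*) al be (conjc al) (conjc be) N.
(* Small transformed momentum makes the prefactor nonzero, so the Hermite sum itself vanishes; on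
   the unit circle [1 / u] is the conjugate of [u]. *)
have rootT (x y : R) : x ^+ 2 + y ^+ 2 = 1 -> (Rad * (S 1 0 * x + S 1 1 * y)) ^+ 2 < hbar ->
    root T (x +i* y).
  move=> xy small.
  have uu : (x +i* y) * (x +i* y)^* = 1 :> R[i].
    by apply/eqP; rewrite conjCc eq_complex /=; apply/andP; split; apply/eqP; [rewrite -xy|]; ring.
  have u0 : x +i* y != 0 :> R[i].
    by apply/eqP => u0; move: uu; rewrite u0 mul0r => /esym/eqP; rewrite oner_eq0.
  rewrite /root /T horner_wignerp // mulf_eq0; apply/orP; right.
  have /vanish : (Rad * x) ^+ 2 + (Rad * y) ^+ 2 = Rad ^+ 2.
    by rewrite !exprMn -mulrDr xy mulr1.
  rewrite hermite_formE /= => /eqP; rewrite mulf_eq0 (negPf (wigner_prefactor_neq0 _ hbar0 _ _ _)) //=; last first.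
    by rewrite (_ : _ + _ = Rad * (S 1 0 * x + S 1 1 * y)) //; ring.
  rewrite unit_complexE //.
  have ea : conjc be * (x +i* y) + conjc al * conjc (x +i* y) =
      ((S 0 0 * (Rad * x) + S 0 1 * (Rad * y)) / r) -i*
      ((S 1 0 * (Rad * x) + S 1 1 * (Rad * y)) / r).
    apply/eqP; rewrite eq_complex /al /be /rho /=.
    by apply/andP; split; apply/eqP; field; rewrite gt_eqF.
  have eb : al * (x +i* y) + be * conjc (x +i* y) =
      ((S 0 0 * (Rad * x) + S 0 1 * (Rad * y)) / r) +i*
      ((S 1 0 * (Rad * x) + S 1 1 * (Rad * y)) / r).
    apply/eqP; rewrite eq_complex /al /be /rho /=.
    by apply/andP; split; apply/eqP; field; rewrite gt_eqF.
  by rewrite ea eb.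
have T0 : T = 0.
  pose s := Num.sqrt (S 1 0 ^+ 2 + S 1 1 ^+ 2).
  have s2 : s ^+ 2 = S 1 0 ^+ 2 + S 1 1 ^+ 2 by rewrite sqr_sqrtr // addr_ge0 ?sqr_ge0.
  have s0 : 0 < s.
    rewrite sqrtr_gt0 lt0r addr_ge0 ?sqr_ge0 // andbT.
    rewrite paddr_eq0 ?sqr_ge0 // !sqrf_eq0; apply/negP => /andP[/eqP e1 /eqP e2].
    by move: det2; rewrite e1 e2 !mulr0 subrr => /esym/eqP; rewrite oner_eq0.
  pose D := (Rad * s) ^+ 2 / hbar.
  have D0 : 0 < D by rewrite divr_gt0 // exprn_gt0 // mulr_gt0.
  (* Infinitely many distinct heights with [D * y k ^+ 2 < 1], which says that the momentum
     [Rad * s * y k] has square below [hbar]. *)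
  pose y (k : nat) : R := (1 + D)^-1 / k.+1%:R.
  have y0 k : 0 < y k by rewrite divr_gt0 // invr_gt0 addr_gt0.
  have yD k : y k * (1 + D) <= 1.
    rewrite /y mulrAC mulVf ?mul1r ?gt_eqF ?addr_gt0 //.
    by rewrite invf_le1 ?ler1n.
  have yinj : injective y.
    have D1 : (1 + D)^-1 != 0 by rewrite invr_neq0 // gt_eqF // addr_gt0.
    by move=> i j /(mulfI D1)/invr_inj/eqP; rewrite eqr_nat => /eqP[].
  pose v k := Num.sqrt (1 - y k ^+ 2).
  have vy k : v k ^+ 2 = 1 - y k ^+ 2.
    by rewrite sqr_sqrtr // subr_ge0; have := y0 k; have := yD k; nra.
  (* The unit vector [(v k, y k)] is rotated so that its product with the second row of [S], of norm
     [s], equals [s * y k]. *)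
  apply: (@poly_eq0_infinite_roots R[i] T (fun k => ((S 1 1 * v k + S 1 0 * y k) / s) +i*
      ((S 1 1 * y k - S 1 0 * v k) / s))).
    have sV0 : s^-1 != 0 by rewrite invr_neq0 // gt_eqF.
    move=> i j [/(mulIf sV0) e1 /(mulIf sV0) e2].
    apply: yinj; apply: (mulfI (x := s ^+ 2)); first by rewrite gt_eqF // exprn_gt0.
    rewrite s2.
    transitivity (S 1 0 * (S 1 1 * v i + S 1 0 * y i) + S 1 1 * (S 1 1 * y i - S 1 0 * v i)).
      by ring.
    by rewrite e1 e2; ring.
  move=> k; apply: rootT.
    rewrite !expr_div_n -mulrDl.
    have -> : (S 1 1 * v k + S 1 0 * y k) ^+ 2 + (S 1 1 * y k - S 1 0 * v k) ^+ 2 =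
       (S 1 0 ^+ 2 + S 1 1 ^+ 2) * (v k ^+ 2 + y k ^+ 2) by ring.
    by rewrite -s2 vy subrK mulr1 divff // gt_eqF // exprn_gt0.
  have -> : S 1 0 * ((S 1 1 * v k + S 1 0 * y k) / s) +
     S 1 1 * ((S 1 1 * y k - S 1 0 * v k) / s) = s * y k.
    transitivity ((S 1 0 ^+ 2 + S 1 1 ^+ 2) * y k / s); first by ring.
    by rewrite -s2; field; rewrite gt_eqF.
  rewrite mulrA exprMn.
  have -> : (Rad * s) ^+ 2 = D * hbar by rewrite /D mulfVK // gt_eqF.
  rewrite mulrAC gtr_pMl //.
  by have := y0 k; have := yD k; nra.
have B0 n : (B n == 0) = (b n == 0).
  by rewrite /B mulf_eq0 fmorph_eq0 (gt_eqF (hermite_norm_gt0 _)) orbF.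
have B'0 n : ((B n)^* == 0) = (b n == 0) by rewrite conjC_eq0 B0.
have char0 n : n.+1%:R != 0 :> R[i] by rewrite pnatr_eq0.
have ab0 : al * conjc be = 0.
  by apply: (wignerp_top _ _ _ _ _ _ _ char0 T0); rewrite ?B0 ?B'0.
(* This difference of squared moduli is [rho ^ 2 * \det S]; being positive, it rules out [al = 0]
   and leaves [be = 0]. *)
have ab : al * conjc al - be * conjc be = (rho ^+ 2)%:C.
  apply/eqP; rewrite eq_complex /al /be /=; apply/andP; split; apply/eqP; last by ring.
  transitivity (rho ^+ 2 * (S 0 0 * S 1 1 - S 0 1 * S 1 0)); first by field.
  by rewrite det2 mulr1.
have be0 : be = 0.
  move/eqP: ab0; rewrite mulf_eq0 conjc_eq0 => /orP[/eqP a0|/eqP//].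
  move: ab; rewrite a0 mul0r sub0r => /(congr1 (@complex.Re R)) /=.
  set g := rho / 2 * _; set h := rho / 2 * _ => e; exfalso.
  have := exprn_gt0 2 rho0; have := sqr_ge0 g; have := sqr_ge0 h.
  by move: e; rewrite mulrN -!expr2; lra.
have aa : al * conjc al = (rho ^+ 2)%:C by rewrite -ab be0 mul0r subr0.
have exb : exists n, b n != 0 by exists N.
case: (ex_minnP exb) => M bM minM.
have MN : (M <= N)%N by exact: minM.
have lowM m : (m < M)%N -> (B m)^* = 0.
  move=> mM; apply/eqP; rewrite B'0; apply/negPn/negP => /minM.
  by rewrite leqNgt mM.
have := wignerp_low _ _ _ _ _ _ _ M be0 (_ : conjc be = 0) T0.
rewrite be0 conjc0 B0 B'0 => /(_ erefl bN bM MN lowM).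
(* Every factor other than the Laguerre value is nonzero, and [rho ^ 2 = Rad ^ 2 / hbar]. *)
rewrite (@ito_laguerre R _ _ (rho ^+ 2)) //; last by rewrite mulrC.
move=> /eqP; rewrite !mulf_eq0 expf_eq0 mulf_eq0 conjc_eq0 (negPf (char0 1)) /=.
have al0 : al != 0.
  apply/eqP => a0; move: aa; rewrite a0 mul0r => /esym/eqP.
  by rewrite fmorph_eq0 sqrf_eq0 gt_eqF.
rewrite (negPf al0) andbF /= pnatr_eq0 -[m in (m`! == 0)%N]/M.
rewrite (gtn_eqF (fact_gt0 M)) /= expf_eq0 oppr_eq0 (negPf (char0 1)) andbF /=.
rewrite fmorph_eq0 => /eqP L0; exists M, (N - M)%N; split; last first.
  by rewrite -L0 /rho expr_div_n rr.
(* The degree is positive because the Laguerre polynomial of degree 0 is the constant 1. *)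
rewrite lt0n; apply/eqP => M0; move: L0; rewrite M0 /laguerre big_ord_recl big_ord0.
rewrite /= subn0 bin0 !expr0 !mulr1 fact0 divr1 addr0 => /eqP.
by rewrite oner_eq0.
Qed.

End Circle.

(** * Radii as Laguerre roots, and their countability *)

Lemma sqrt_radius {R : realType} (hbar Rad : R) : 0 < hbar -> 0 < Rad ->
  Rad = Num.sqrt (hbar * (2 * (Rad ^+ 2 / hbar)) / 2).
Proof.
move=> h0 R0; rewrite [X in Num.sqrt X](_ : _ = Rad ^+ 2); last first.
  by field; rewrite gt_eqF.
by rewrite sqrtr_sqr gtr0_norm.
Qed.

Theorem theorem6 (R : realType) (hbar : R) (hhbar : 0 < hbar) :
  (forall (f : R -> R[i]) (Rad : R),
     L2 f -> bounded_nodal_set hbar f -> wigner_centered_at hbar f (0, 0) ->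
     0 < Rad -> vanishes_on_circle hbar f Rad ->
     exists (n k : nat) (p : R),
       (0 < n)%N /\ laguerre n k p = 0 /\ Rad = Num.sqrt (hbar * p / 2)) /\
  countable [set Rad : R | 0 < Rad /\
     exists f : R -> R[i], [/\ L2 f, bounded_nodal_set hbar f,
       wigner_centered_at hbar f (0, 0) & vanishes_on_circle hbar f Rad]].
Proof.
have main : forall (f : R -> R[i]) (Rad : R),
     L2 f -> bounded_nodal_set hbar f -> wigner_centered_at hbar f (0, 0) ->
     0 < Rad -> vanishes_on_circle hbar f Rad ->
     exists (n k : nat) (p : R),
       (0 < n)%N /\ laguerre n k p = 0 /\ Rad = Num.sqrt (hbar * p / 2).
  move=> f Rad _ [K bnd] [N [b [S [detS E]]]] Rad0 van.
  have {}E x p : wigner hbar f f x p =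
      hermite_form hbar N b (mx_act S (x, p)).1 (mx_act S (x, p)).2.
    by have := E (x, p); rewrite /= !subr0.
  have [Z|[N' bN' Z]] := hermite_form_reduce hbar N b.
    (* If the form vanishes identically, every point is nodal, and [(|K| + 1, 0)] lies outside the
       bounding disc. *)
    exfalso; have := bnd (`|K| + 1) 0; rewrite E Z => /(_ erefl).
    rewrite expr0n /= addr0 -[in X in _ <= X](real_normK (num_real K)).
    by have := normr_ge0 K; nra.
  have [|n [k [n0 L0]]] := hermite_form_circle _ hhbar _ _ _ _ detS bN' Rad0.
    by move=> x p xp; rewrite -Z -E van.
  by exists n, k, (2 * (Rad ^+ 2 / hbar)); split=> //; split=> //; exact: sqrt_radius.
split=> //.
(* The radii lie in a union, over countably many pairs [(n, k)], of images of finite root sets. *)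
pose F (nk : nat * nat) := (fun p : R => Num.sqrt (hbar * p / 2)) @`
  [set p | laguerre nk.1 nk.2 p = 0].
apply: (@sub_countable _ _ _ (\bigcup_(nk in setT) F nk)).
  apply: subset_card_le => Rad [Rad0 [f [f2 fb fc fv]]].
  have [n [k [p [_ [L0 ->]]]]] := main f Rad f2 fb fc Rad0 fv.
  by exists (n, k) => //; exists p.
apply: bigcup_countable => [|nk _]; first exact: countableP.
by apply/finite_set_countable/finite_image; exact: finite_roots_laguerre.
Qed.
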